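(* For any $\delta>0$ there exist a permuton $\mu_\delta$ with a continuous density on $[0,1]^2$ vanishing on $\{0\}\times[\tfrac12,1]$, and a constant $c>0$, such that, if $\mathcal P^n_{\mu_\delta}$ denotes a set of $n$ i.i.d. random points with distribution $\mu_\delta$, $$\lim_{n\to\infty}\mathbb P\left[h\left(\mathcal T\langle\mathcal P^n_{\mu_\delta}\rangle\right)\ge c\,n^{(1-\delta)/2}\right]=1 .$$
   Context: A permuton is a probability measure $\mu$ on $[0,1]^2$ with uniform marginals: $\mu(A\times[0,1])=\mu([0,1]\times A)=\mathrm{Leb}(A)$. Binary search trees: for a finite sequence $y=(y_1,\dots,y_n)$ of distinct reals, $\mathcal T\langle y\rangle$ is the labeled rooted binary tree obtained by inserting $y_1,\dots,y_n$ successively into the empty tree: to insert a value, start at the root, move to the left child if the value is smaller than the label of the current node and to the right child if it is larger, until an empty position is reached, where a new node with this label is created. For a finite set $\mathcal P\subset\mathbb R^2$ of points with distinct $x$- and distinct $y$-coordinates, $\mathcal T\langle\mathcal P\rangle:=\mathcal T\langle y_{(1)},\dots,y_{(n)}\rangle$, where the points $(x_{(i)},y_{(i)})$ of $\mathcal P$ are ordered so that $x_{(1)}<\dots<x_{(n)}$. The height $h(\mathcal T)$ is the maximal distance (number of edges) from a leaf to the root. *)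

(* Defs.v *)
From HB Require Import structures.
From mathcomp Require Import all_boot all_order all_algebra finmap.
From mathcomp Require Import all_classical all_reals all_analysis.

Set Implicit Arguments.
Unset Strict Implicit.
Unset Printing Implicit Defensive.

Import Order.TTheory GRing.Theory Num.Theory.
Import numFieldNormedType.Exports.

Local Open Scope classical_set_scope.
Local Open Scope ring_scope.

Inductive binary_tree (T : Type) : Type :=
| Empty
| Node (left : binary_tree T) (label : T) (right : binary_tree T).
Arguments Empty {T}.

Definition is_empty (T : Type) (t : binary_tree T) : bool :=
  if t is Empty then true else false.

(* Number of edges of a longest path from the root to a leaf, a leaf being a
   node whose two subtrees are empty. The empty tree gets the value 0. *)
Fixpoint height (T : Type) (t : binary_tree T) : nat :=
  match t with
  | Empty => 0%N
  | Node l _ r =>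
      if is_empty l && is_empty r then 0%N else (maxn (height l) (height r)).+1
  end.

(* The case y = x does not occur when the inserted values are distinct. *)
Fixpoint bst_insert (disp : Order.disp_t) (T : orderType disp)
    (t : binary_tree T) (y : T) : binary_tree T :=
  match t with
  | Empty => Node Empty y Empty
  | Node l x r =>
      if (y < x)%O then Node (bst_insert l y) x r
      else Node l x (bst_insert r y)
  end.

Definition bst_of_seq (disp : Order.disp_t) (T : orderType disp) (s : seq T) :
    binary_tree T :=
  foldl (@bst_insert disp T) Empty s.

(* The second coordinate only breaks ties: when the points have distinct first
   coordinates, sorting by this relation is sorting by first coordinate. *)
Definition lexi_le (R : realType) (p q : R * R) : bool :=
  (p.1 < q.1) || ((p.1 == q.1) && (p.2 <= q.2)).

Definition bst_of_points (R : realType) (S : {fset (R * R)%type}) :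
    binary_tree R :=
  bst_of_seq [seq p.2 | p <- sort (@lexi_le R) (enum_fset S)].

Definition unit_square (R : realType) : set (R * R) := `[0, 1] `*` `[0, 1].

(* Taking A = `[0, 1] in the marginal conditions gives mass 1 to the unit
   square, so that mu is a probability measure on it. *)
Definition is_permuton (R : realType) (mu : probability (R * R)%type R) : Prop :=
  forall A : set R, measurable A -> A `<=` `[0, 1] ->
    mu (A `*` `[0, 1]) = lebesgue_measure A /\
    mu (`[0, 1] `*` A) = lebesgue_measure A.

Definition has_continuous_density (R : realType)
    (mu : probability (R * R)%type R) (rho : R * R -> R) : Prop :=
  [/\ {within @unit_square R, continuous rho},
      (forall z, unit_square z -> 0 <= rho z) &
      forall A : set (R * R), measurable A -> A `<=` @unit_square R ->
        mu A = (\int[@lebesgue_measure R \x @lebesgue_measure R]_(z in A)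
                  (rho z)%:E)%E].

Definition mutually_independent (R : realType) (d d' : measure_display)
    (T : measurableType d) (T' : measurableType d') (P : probability T R)
    (n : nat) (X : 'I_n -> {RV P >-> T'}) : Prop :=
  forall A : 'I_n -> set T', (forall i, measurable (A i)) ->
    P (\bigcap_i (X i @^-1` A i)) = (\prod_i P (X i @^-1` A i))%E.

Definition iid (R : realType) (d d' : measure_display)
    (T : measurableType d) (T' : measurableType d') (P : probability T R)
    (n : nat) (X : 'I_n -> {RV P >-> T'}) (mu : probability T' R) : Prop :=
  mutually_independent X /\
  forall (i : 'I_n) (A : set T'), measurable A -> distribution P (X i) A = mu A.

Definition random_points (R : realType) (d : measure_display)
    (T : measurableType d) (P : probability T R)
    (n : nat) (X : 'I_n -> {RV P >-> (R * R)%type}) (w : T) :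
    {fset (R * R)%type} :=
  [fset X i w | i in 'I_n]%fset.

(* Main.v *)
Require Import Defs.
From HB Require Import structures.
From mathcomp Require Import all_boot all_order all_algebra finmap.
From mathcomp Require Import all_classical all_reals all_analysis.
From mathcomp Require Import measurable_realfun.
From mathcomp Require Import lra ring zify.

Set Implicit Arguments.
Unset Strict Implicit.
Unset Printing Implicit Defensive.

Import Order.TTheory GRing.Theory Num.Theory.
Import numFieldNormedType.Exports.

Local Open Scope classical_set_scope.
Local Open Scope ring_scope.

(* Let the density be h (y - x mod 1), with h continuous, supported on [0, 1/2] and
   of order s ^ eps at distance s from 1/2: translation invariance makes the
   marginals uniform, and no point lies above the line y = x + 1/2. Cut this line
   into m pieces of width w = 1 / (2 m). The upper left quadrant with corner
   (x_(j+1), x_j + 1/2) meets the support in a triangle of mass of order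
   w ^ (2 + eps). If each of these triangles contains a point, then for every j
   the leftmost point above height x_j + 1/2 lies below height x_(j+1) + 1/2, so
   that these leftmost points are m successive ancestors in the search tree. With
   m of order n ^ b and b (2 + eps) < 1, a given triangle is empty with
   probability at most exp (- C n ^ (1 - b (2 + eps))), and a union bound
   suffices. *)

(** * Heights of binary search trees *)

(** Counting nodes along a path instead of edges removes the special case of leaves, which makes the
    recursion uniform. *)
Fixpoint levels (T : Type) (t : binary_tree T) : nat :=
  match t with
  | Defs.Empty => 0%N
  | Node l _ r => (maxn (levels l) (levels r)).+1
  end.

Lemma height_levels (T : Type) (t : binary_tree T) : height t = (levels t).-1.
Proof.
elim: t => [//|l IHl x r IHr] /=.
case: l r IHl IHr => [|ll lx lr] [|rl rx rr] //=.
- by rewrite !max0n => _ ->.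
- by rewrite !maxn0 => ->.
- by move=> -> ->; rewrite maxnSS.
Qed.

Section BinarySearchTrees.
Context (disp : Order.disp_t) (T : orderType disp).
Implicit Types (s : seq T) (x y : T).

(** Each later value is sent to one side of the root and the two sides never interact, so insertion
    is the quicksort recursion; filtering keeps the order of insertion on each side. *)
Lemma foldl_bst_insert_Node s l x r :
  foldl (@bst_insert disp T) (Node l x r) s =
  Node (foldl (@bst_insert disp T) l [seq y <- s | (y < x)%O]) x
       (foldl (@bst_insert disp T) r [seq y <- s | (x <= y)%O]).
Proof.
elim: s l r => [//|y s IHs] l r /=.
by case: ltP => _; rewrite IHs.
Qed.

Lemma bst_of_seq_cons x s :
  bst_of_seq (x :: s) =
  Node (bst_of_seq [seq y <- s | (y < x)%O]) x
       (bst_of_seq [seq y <- s | (x <= y)%O]).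
Proof. exact: foldl_bst_insert_Node. Qed.

(** Induction on the size of [s], always descending into the right subtree of the root. For each
    [j], the first value at or above [a j] lies below [a j.+1], so these values are distinct for
    distinct [j] and occur one after another on the descent. *)
Lemma levels_bst_of_seq_ge (a : nat -> T) m i s :
    {homo a : j k / (j <= k)%N >-> (j <= k)%O} ->
    (forall j, (i <= j < m)%N ->
       exists v s', [seq y <- s | (a j <= y)%O] = v :: s' /\ (v < a j.+1)%O) ->
  (m - i <= levels (bst_of_seq s))%N.
Proof.
move=> a_homo; have [k] := ubnP (size s); elim: k s i => // k IHk [|x s] i.
  case: (ltnP i m) => [im _ /(_ i)|mi _ _]; last by rewrite (eqP mi).
  by rewrite leqnn im => /(_ isT)[v [s' []]].
rewrite ltnS => /= sk lvl.
have [im|/eqP->//] := ltnP i m.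
rewrite bst_of_seq_cons /=.
apply: (@leq_trans (levels (bst_of_seq [seq y <- s | (x <= y)%O])).+1);
  last by rewrite ltnS leq_maxr.
have fs : (size [seq y <- s | (x <= y)%O] < k)%N.
  by rewrite (leq_ltn_trans _ sk)// size_filter count_size.
(* For a threshold above the root, passing to the right subtree discards no value at or above that
   threshold. *)
have restrict j : (i <= j < m)%N -> (x < a j)%O ->
    exists v s', [seq y <- [seq y <- s | (x <= y)%O] | (a j <= y)%O] = v :: s'
      /\ (v < a j.+1)%O.
  move=> ijm xaj; have [v [s' []]] := lvl _ ijm.
  rewrite leNgt xaj /= => sv va; exists v, s'; split=> //; rewrite -sv.
  rewrite -filter_predI; apply: eq_filter => y /=.
  by case: leP => //= /(le_trans (ltW xaj)) ->.
have [xai|aix] := ltP x (a i).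
  apply: leqW; apply: IHk => // j ijm; apply: restrict => //.
  by rewrite (lt_le_trans xai)// a_homo//; case/andP: ijm.
(* Now the root is itself the first value at or above [a i], hence below [a i.+1]: it accounts for
   index [i], and all later indices are left to the right subtree. *)
have /lvl : (i <= i < m)%N by rewrite leqnn.
rewrite aix => -[v [s' [[<- _]]]] xai1.
suff : (m - i.+1 <= levels (bst_of_seq [seq y <- s | (x <= y)%O]))%N by lia.
apply: IHk => // j /andP[ij jm]; apply: restrict; first by rewrite ltnW.
by rewrite (lt_le_trans xai1)// a_homo.
Qed.

End BinarySearchTrees.

Section SortedPoints.
Context (R : realType).
Implicit Types (p q : R * R).

Lemma lexi_le_total : total (@lexi_le R).
Proof.
move=> p q; rewrite /lexi_le; case: (ltgtP p.1 q.1) => //= _.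
exact: le_total.
Qed.

Lemma lexi_le_trans : transitive (@lexi_le R).
Proof.
move=> q p r /orP[pq|/andP[/eqP pq1 pq2]] /orP[qr|/andP[/eqP qr1 qr2]];
  rewrite /lexi_le.
- by rewrite (lt_trans pq qr).
- by rewrite -qr1 pq.
- by rewrite pq1 qr.
- by rewrite pq1 qr1 eqxx (le_trans pq2 qr2) orbT.
Qed.

Lemma lexi_le_anti : antisymmetric (@lexi_le R).
Proof.
move=> [a b] [c d]; rewrite /lexi_le /=.
by case: (ltgtP a c) => //= <- /le_anti ->.
Qed.

Lemma lexi_le_fst p q : lexi_le p q -> p.1 <= q.1.
Proof. by case/orP => [/ltW//|/andP[/eqP ->]]. Qed.

(* The leftmost point above the level [x j + shift] lies left of the given
   point, hence, by the bound on the support, below the level [x j.+1 + shift]. *)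
Lemma height_bst_of_points_ge (S : {fset (R * R)%type}) (shift : R)
    (x : nat -> R) (m : nat) :
    {homo x : j k / (j <= k)%N >-> j <= k} ->
    (forall p, p \in S -> p.2 <= p.1 + shift) ->
    (forall j, (j < m)%N ->
       exists2 p, p \in S & p.1 < x j.+1 /\ x j + shift <= p.2) ->
  (m.-1 <= height (bst_of_points S))%N.
Proof.
move=> x_homo S_le occ; rewrite height_levels.
set s := [seq p.2 | p <- sort (@lexi_le R) (enum_fset S)].
suff : (m - 0 <= levels (bst_of_seq s))%N by rewrite subn0 -!subn1 => /leq_sub2r; exact.
apply: (@levels_bst_of_seq_ge _ _ (fun j => x j + shift)) => [j k jk|j /andP[_ jm]].
  by rewrite lerD2r x_homo.
have [p pS [px py]] := occ _ jm.
rewrite /s filter_map; set t := [seq q <- _ | _].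
have pt : p \in t by rewrite mem_filter mem_sort /= py.
have st : sorted (@lexi_le R) t.
  by apply: (sorted_filter lexi_le_trans); exact: (sort_sorted lexi_le_total).
have tS q : q \in t -> q \in S by rewrite mem_filter mem_sort => /andP[].
case: t pt st tS => // v t' pt st tS.
exists v.2, [seq q.2 | q <- t']; split=> //.
have vp : lexi_le v p.
  move: pt; rewrite inE => /predU1P[->|pt']; first by case/orP: (lexi_le_total v v).
  by have /allP/(_ _ pt') := order_path_min lexi_le_trans st.
have vS := S_le _ (tS _ (mem_head _ _)).
have : v.2 < x j.+1 + shift by have := lexi_le_fst vp; lra.
by [].
Qed.

End SortedPoints.

(** * Measurability of the height *)

(** The shape of the tree depends only on the outcomes of comparisons. The induction is on the size,
    since the recursive calls act on filtered sequences. *)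
Lemma levels_bst_of_seq_map (disp disp' : Order.disp_t) (T : orderType disp)
    (T' : orderType disp') (I : Type) (f : I -> T) (g : I -> T') (s : seq I) :
    (forall i j, (f i < f j)%O = (g i < g j)%O) ->
  levels (bst_of_seq [seq f i | i <- s]) =
  levels (bst_of_seq [seq g i | i <- s]).
Proof.
move=> fg; have [k] := ubnP (size s); elim: k s => // k IHk [//|i s].
rewrite ltnS => /= sk; rewrite !bst_of_seq_cons /= !filter_map.
have sz (a : pred I) : (size (seq.filter a s) < k)%N.
  by rewrite (leq_ltn_trans _ sk)// size_filter count_size.
have fl : preim f (fun y => (y < f i)%O) =1 preim g (fun y => (y < g i)%O).
  by move=> j /=; rewrite fg.
have fr : preim f (fun y => (f i <= y)%O) =1 preim g (fun y => (g i <= y)%O).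
  by move=> j /=; rewrite !leNgt fg.
by rewrite (eq_filter fl) (eq_filter fr) !IHk ?sz.
Qed.

Section ComparisonPattern.
Context (R : realType) (n : nat).
Implicit Types z : 'I_n -> R * R.

(** A statistic with finitely many values that determines the height: the first component governs
    the sorting of the points, the second the insertion into the tree. *)
Definition comparison_pattern z : {ffun 'I_n * 'I_n -> bool * bool} :=
  [ffun ij => (lexi_le (z ij.1) (z ij.2), (z ij.1).2 < (z ij.2).2)].

(** A finite set merges equal points, so only the least index of each point is retained; equality of
    points is read off [r] as comparison in both directions. *)
Definition sorted_indices (r : rel 'I_n) : seq 'I_n :=
  sort r [seq i : 'I_n <- enum 'I_n |
    [forall j : 'I_n, (j < i)%N ==> ~~ (r i j && r j i)]].

Lemma sort_random_points z :
  sort (@lexi_le R) (enum_fset [fset z i | i in 'I_n]%fset) =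
  [seq z i | i <- sorted_indices (relpre z (@lexi_le R))].
Proof.
rewrite /sorted_indices -sort_map; apply/(perm_sortP (@lexi_le_total R)).
  exact: lexi_le_trans.
  exact: lexi_le_anti.
have zE i j : lexi_le (z i) (z j) && lexi_le (z j) (z i) = (z i == z j).
  apply/idP/eqP => [/lexi_le_anti//|->]; rewrite andbb.
  by case/orP: (lexi_le_total (z j) (z j)).
apply: uniq_perm; first exact: fset_uniq.
  rewrite map_inj_in_uniq; first by apply: filter_uniq; exact: enum_uniq.
  move=> i j.
  rewrite !mem_filter => /andP[/forallP mi _] /andP[/forallP mj _] zij.
  case: (ltngtP i j) => [lt|lt|/ord_inj//]; exfalso.
  - by have := mj i; rewrite /= zE zij eqxx lt.
  - by have := mi j; rewrite /= zE zij eqxx lt.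
move=> p; apply/imfsetP/mapP => -[i ip ->]; last by exists i.
pose P := [pred j | z j == z i]; have Pi : P i by exact: eqxx.
(* The least index carrying the same point as [i] is the one that passes the filter. *)
case: (arg_minnP (@nat_of_ord n) Pi) => j /eqP zj minj; exists j => //.
rewrite mem_filter mem_enum andbT; apply/forallP => k; apply/implyP => kj.
rewrite /= zE zj; apply: contraL kj => /eqP zk.
by rewrite -leqNgt; apply: minj; rewrite /P /= zk.
Qed.

Lemma height_comparison_pattern z z' :
    comparison_pattern z = comparison_pattern z' ->
  height (bst_of_points [fset z i | i in 'I_n]%fset) =
  height (bst_of_points [fset z' i | i in 'I_n]%fset).
Proof.
move=> /ffunP zz'.
have lexE i j : lexi_le (z i) (z j) = lexi_le (z' i) (z' j).
  by have := zz' (i, j); rewrite !ffunE => -[].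
have ltE i j : ((z i).2 < (z j).2) = ((z' i).2 < (z' j).2).
  by have := zz' (i, j); rewrite !ffunE => -[].
rewrite !height_levels /bst_of_points !sort_random_points -!map_comp.
have -> : relpre z (@lexi_le R) = relpre z' (@lexi_le R) :> rel _.
  by apply/funext => i; apply/funext => j; exact: lexE.
by congr _.-1; exact: levels_bst_of_seq_map.
Qed.

End ComparisonPattern.

Section MeasurableHeight.
Context (R : realType) (d : measure_display) (T : measurableType d).
Context (P : probability T R) (n : nat).
Variable X : 'I_n -> {RV P >-> (R * R)%type}.

Lemma measurable_comparison_pattern (c : {ffun 'I_n * 'I_n -> bool * bool}) :
  measurable [set w | comparison_pattern (fun i => X i w) = c].
Proof.
have mX1 i : measurable_fun [set: T] (fun w => (X i w).1).
  by apply: measurableT_comp; [exact: measurable_fst|exact: measurable_funPT].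
have mX2 i : measurable_fun [set: T] (fun w => (X i w).2).
  by apply: measurableT_comp; [exact: measurable_snd|exact: measurable_funPT].
rewrite [X in measurable X](_ : _ = \bigcap_(ij in [set: 'I_n * 'I_n])
  ((fun w => lexi_le (X ij.1 w) (X ij.2 w)) @^-1` [set (c ij).1] `&`
   (fun w => (X ij.1 w).2 < (X ij.2 w).2) @^-1` [set (c ij).2])); last first.
  apply/seteqP; split => w /=.
    by move=> cw [i j] _; rewrite /= -cw ffunE.
  move=> cw; apply/ffunP => ij; rewrite ffunE.
  have [/= -> ->] := cw ij I.
  by rewrite -surjective_pairing.
apply: fin_bigcap_measurable => [|[i j] _ /=]; first exact: finite_finset.
apply: measurableI; rewrite -[X in measurable X]setTI.
- exact: (measurable_or (measurable_fun_ltr (mX1 i) (mX1 j))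
    (measurable_and (measurable_fun_eqr (mX1 i) (mX1 j))
                    (measurable_fun_ler (mX2 i) (mX2 j)))).
- exact: (measurable_fun_ltr (mX2 i) (mX2 j)).
Qed.

(** The height is a function of the comparison pattern, so the event is a finite union of the
    measurable events on which the pattern is fixed. *)
Lemma measurable_height_ge (r : R) :
  measurable [set w | r <= (height (bst_of_points (random_points X w)))%:R].
Proof.
pose A := [set c | exists2 w, comparison_pattern (fun i => X i w) = c &
  r <= (height (bst_of_points (random_points X w)))%:R].
rewrite [X in measurable X](_ : _ =
  \bigcup_(c in A) [set w | comparison_pattern (fun i => X i w) = c]).
  apply: fin_bigcup_measurable => [|c _]; first exact: finite_finset.
  exact: measurable_comparison_pattern.
apply/seteqP; split => [w /= rw|w [c [w' cw' rw'] /= cw]].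
  by exists (comparison_pattern (fun i => X i w)) => //; exists w.
by rewrite /random_points (height_comparison_pattern (etrans cw (esym cw'))).
Qed.

End MeasurableHeight.

(** * A permuton with a prescribed boundary behaviour *)

Section Primitive.
Context (R : realType) (h : R -> R).
Local Notation lambda := (@lebesgue_measure R).
Hypothesis h_cont : continuous h.
Hypothesis h_left : forall t : R, t <= 0 -> h t = 0.
Hypothesis h_right : forall t : R, 1 <= t -> h t = 0.

(* The lower bound -3 leaves room for differentiating at -1, the smallest value
   of y - x on the unit square. *)
Definition primitive (t : R) : R := \int[lambda]_(u in `[-3, t]) h u.

Lemma is_derive_primitive (t : R) : -3 < t -> is_derive t 1 primitive (h t).
Proof.
move=> t3.
(* The endpoint [t + 1] only serves to make [t] an interior point. *)
have intf : lambda.-integrable `[-3, t + 1] (EFin \o h).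
  apply: continuous_compact_integrable; first exact: segment_compact.
  exact: continuous_subspaceT.
have tt1 : t < t + 1 by rewrite ltrDl.
have [dP P'] := continuous_FTC1_closed tt1 intf t3 (h_cont (x:=t)).
apply: DeriveDef; first exact: dP.
by rewrite -derive1E P'.
Qed.

Lemma primitive_le0 (t : R) : t <= 0 -> primitive t = 0.
Proof.
move=> t0; rewrite /primitive.
under eq_Rintegral => u.
  rewrite inE /= in_itv /= => /andP[_ ut]; rewrite h_left ?(le_trans ut)//.
  over.
by rewrite Rintegral_cst//= mul0r.
Qed.

Lemma primitive_ge1 (t : R) : 1 <= t -> primitive t = \int[lambda]_(u in `[0, 1]) h u.
Proof.
move=> t1; rewrite /primitive Rintegral_mkcond [RHS]Rintegral_mkcond.
congr Rintegral; apply/funext => u; rewrite !patchE !mem_setE !in_itv /=.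
have [u0|u0] := leP u 0; first by rewrite h_left//; do 2 case: ifP => //.
have [u1|u1] := leP 1 u; first by rewrite h_right//; do 2 case: ifP => //.
by rewrite !ltW ?(lt_le_trans u1)//; lra.
Qed.

End Primitive.

Lemma integral_is_derive (R : realType) (f F : R -> R) (a b : R) :
    a < b -> continuous f -> (forall x, a <= x <= b -> is_derive x 1 F (f x)) ->
  (\int[@lebesgue_measure R]_(x in `[a, b]) (f x)%:E = (F b - F a)%:E)%E.
Proof.
move=> ab f_cont dF; rewrite (@continuous_FTC2 _ _ F)//.
- exact: continuous_subspaceT.
- have cF x : a <= x <= b -> F y @[y --> x] --> F x.
    move=> /dF dFx; apply: differentiable_continuous.
    by apply/derivable1_diffP; exact: ex_derive.
  split.
  + move=> x; rewrite in_itv /= => /andP[ax xb].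
    by have := dF x; rewrite !ltW// => /(_ isT) ?; exact: ex_derive.
  + by apply: cvg_at_right_filter; apply: cF; rewrite lexx ltW.
  + by apply: cvg_at_left_filter; apply: cF; rewrite lexx ltW.
- move=> x; rewrite in_itv /= => /andP[ax xb].
  have := dF x; rewrite !ltW// => /(_ isT) ?.
  by rewrite derive1E derive_val.
Qed.

(** * Uniform marginals of a density wrapped along the diagonal *)

Section WrappedDensity.
Context (R : realType) (h : R -> R).
Local Notation lambda := (@lebesgue_measure R).
Hypothesis h_cont : continuous h.
Hypothesis h_ge0 : forall t : R, 0 <= h t.
Hypothesis h_left : forall t : R, t <= 0 -> h t = 0.
Hypothesis h_right : forall t : R, 1 <= t -> h t = 0.
Hypothesis h_int1 : \int[lambda]_(u in `[0, 1]) h u = 1.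

(* h applied to y - x modulo 1, as y - x ranges over [-1, 1] *)
Definition wrap (z : R * R) : R := h (z.2 - z.1) + h (z.2 - z.1 + 1).

Lemma wrap_ge0 z : 0 <= wrap z.
Proof. by rewrite addr_ge0. Qed.

Lemma wrap_continuous : continuous wrap.
Proof.
move=> z; have sub : (y.2 - y.1) @[y --> z] --> z.2 - z.1.
  by apply: cvgB; [exact: cvg_snd|exact: cvg_fst].
apply: cvgD; apply: continuous_cvg; try exact: h_cont; first exact: sub.
by apply: cvgD; [exact: sub|exact: cvg_cst].
Qed.

Lemma measurable_wrap : measurable_fun [set: R * R] wrap.
Proof.
have mh := continuous_measurable_fun h_cont.
have sub : measurable_fun [set: R * R] (fun z : R * R => z.2 - z.1).
  by apply: measurable_funB; [exact: measurable_snd|exact: measurable_fst].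
apply: measurable_funD; apply: (measurableT_comp mh); first exact: sub.
by apply: measurable_funD; [exact: sub|exact: measurable_cst].
Qed.

Let is_derive_affine (k a t : R) : -3 < k * t + a ->
  is_derive t 1 (fun s => primitive h (k * s + a)) (k * h (k * t + a)).
Proof.
move=> ta; have dp := is_derive_primitive h_cont ta.
have da : is_derive t 1 (fun s => k * s + a) k.
  have -> : (fun s => k * s + a) = (k \*: (@id R)) + cst a by apply/funext.
  by apply: is_derive_eq; rewrite addr0 [_ *: _]mulr1.
have := @is_derive1_comp _ (primitive h) (fun s => k * s + a) t _ _ dp da.
by rewrite mulrC.
Qed.

(** With [F] an antiderivative in [y], the terms [primitive h (1 - x)] cancel in [F 1 - F 0]. What
    remains is [primitive h (2 - x) - primitive h (- x)], the full mass of [h]. *)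
Lemma wrap_column (x : R) : 0 <= x <= 1 ->
  (\int[lambda]_(y in `[0%R, 1%R]) (wrap (x, y))%:E = 1)%E.
Proof.
move=> /andP[x0 x1].
pose F := (fun y : R => primitive h (1 * y - x))
  + (fun y : R => primitive h (1 * y + (1 - x))).
have w_cont : continuous (fun y : R => wrap (x, y)).
  move=> y; have sub : (u - x) @[u --> y] --> y - x.
    by apply: cvgB; [exact: cvg_id|exact: cvg_cst].
  apply: cvgD; apply: continuous_cvg; try exact: h_cont; first exact: sub.
  by apply: cvgD; [exact: sub|exact: cvg_cst].
have dF (y : R) : 0 <= y <= 1 -> is_derive y 1 F (wrap (x, y)).
  move=> /andP[y0 y1].
  have d1 := @is_derive_affine 1 (- x) y ltac:(lra).
  have d2 := @is_derive_affine 1 (1 - x) y ltac:(lra).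
  apply: is_derive_eq.
  by rewrite /wrap /= !mul1r addrA addrAC.
rewrite (integral_is_derive ltr01 w_cont dF) /F !fctE !mul1r !add0r.
rewrite (primitive_le0 h_left (_ : - x <= 0)); last lra.
rewrite (primitive_ge1 h_left h_right (_ : 1 <= 1 + (1 - x))) ?h_int1; last lra.
by congr EFin; lra.
Qed.

Lemma wrap_row (y : R) : 0 <= y <= 1 ->
  (\int[lambda]_(x in `[0%R, 1%R]) (wrap (x, y))%:E = 1)%E.
Proof.
move=> /andP[y0 y1].
(* The variable now enters with a negative sign; the terms [primitive h y] cancel and [primitive h
   (y + 1) - primitive h (y - 1)] remains. *)
pose F := - ((fun x : R => primitive h (-1 * x + y))
  + (fun x : R => primitive h (-1 * x + (y + 1)))).
have w_cont : continuous (fun x : R => wrap (x, y)).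
  move=> x; have sub : (y - u) @[u --> x] --> y - x.
    by apply: cvgB; [exact: cvg_cst|exact: cvg_id].
  apply: cvgD; apply: continuous_cvg; try exact: h_cont; first exact: sub.
  by apply: cvgD; [exact: sub|exact: cvg_cst].
have dF (x : R) : 0 <= x <= 1 -> is_derive x 1 F (wrap (x, y)).
  move=> /andP[x0 x1].
  have d1 := @is_derive_affine (-1) y x ltac:(lra).
  have d2 := @is_derive_affine (-1) (y + 1) x ltac:(lra).
  apply: is_derive_eq.
  by rewrite /wrap /= !mulN1r opprD !opprK addrA [- x + y]addrC.
rewrite (integral_is_derive ltr01 w_cont dF) /F !fctE !mulr0 !add0r !mulr1.
rewrite (primitive_le0 h_left (_ : -1 + y <= 0)); last lra.
rewrite (primitive_ge1 h_left h_right (_ : 1 <= y + 1)) ?h_int1; last lra.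
by rewrite (_ : -1 + (y + 1) = y); [congr EFin|]; lra.
Qed.

End WrappedDensity.

(** * From a density to a permuton *)

Section DensityProbability.
Context (d : measure_display) (T : measurableType d) (R : realType).
Context (nu : {measure set T -> \bar R}).
Local Open Scope ereal_scope.

Lemma exists_density_probability (f : T -> \bar R) :
    measurable_fun [set: T] f -> (forall x, 0 <= f x) -> \int[nu]_x f x = 1 ->
  exists mu : probability T R, forall A, mu A = \int[nu]_(x in A) f x.
Proof.
move=> mf f0 f1; pose m A := \int[nu]_(x in A) f x.
have m0 : m set0 = 0 by exact: integral_set0.
have m_ge0 A : 0 <= m A by exact: integral_ge0.
have m_add := semi_sigma_additive_nng_induced (mu := nu) mf f0.
pose isM := isMeasure.Build _ T R m m0 m_ge0 m_add.
pose M : {measure set T -> \bar R} := HB.pack m isM.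
pose P : probability T R := HB.pack m isM (@Measure_isProbability.Build _ _ R M f1).
by exists P.
Qed.

End DensityProbability.

Section Rectangles.
Context (d1 d2 : measure_display) (T1 : measurableType d1)
  (T2 : measurableType d2) (R : realType).
Context (m1 : {sigma_finite_measure set T1 -> \bar R}).
Context (m2 : {sigma_finite_measure set T2 -> \bar R}).
Local Open Scope ereal_scope.

Lemma integral_setX1 (f : T1 * T2 -> \bar R) (A : set T1) (B : set T2) :
    measurable A -> measurable B -> measurable_fun [set: T1 * T2] f ->
    (forall z, 0 <= f z) ->
  \int[m1 \x m2]_(z in A `*` B) f z =
  \int[m1]_(x in A) \int[m2]_(y in B) f (x, y).
Proof.
move=> mA mB mf f0; rewrite integral_mkcond fubini_tonelli1; last 2 first.
- by apply/(measurable_restrictT _ _).1; [exact: measurableX|exact: measurable_funTS].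
- by move=> z; exact: erestrict_ge0.
rewrite [RHS]integral_mkcond; apply: eq_integral => x _.
rewrite /fubini_F patchE; case: ifPn => xA.
  rewrite [RHS]integral_mkcond; apply: eq_integral => y _.
  by rewrite !patchE in_setX /= xA.
apply: integral0_eq => y _.
by rewrite patchE in_setX /= (negbTE xA).
Qed.

Lemma integral_setX2 (f : T1 * T2 -> \bar R) (A : set T1) (B : set T2) :
    measurable A -> measurable B -> measurable_fun [set: T1 * T2] f ->
    (forall z, 0 <= f z) ->
  \int[m1 \x m2]_(z in A `*` B) f z =
  \int[m2]_(y in B) \int[m1]_(x in A) f (x, y).
Proof.
move=> mA mB mf f0; rewrite integral_mkcond fubini_tonelli2; last 2 first.
- by apply/(measurable_restrictT _ _).1; [exact: measurableX|exact: measurable_funTS].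
- by move=> z; exact: erestrict_ge0.
rewrite [RHS]integral_mkcond; apply: eq_integral => y _.
rewrite /fubini_G patchE; case: ifPn => yB.
  rewrite [RHS]integral_mkcond; apply: eq_integral => x _.
  by rewrite !patchE in_setX /= yB andbT.
apply: integral0_eq => x _.
by rewrite patchE in_setX /= (negbTE yB) andbF.
Qed.

End Rectangles.

Section WrappedPermuton.
Context (R : realType) (h : R -> R).
Local Notation lambda := (@lebesgue_measure R).
Hypothesis h_cont : continuous h.
Hypothesis h_ge0 : forall t : R, 0 <= h t.
Hypothesis h_left : forall t : R, t <= 0 -> h t = 0.
Hypothesis h_right : forall t : R, 1 <= t -> h t = 0.
Hypothesis h_int1 : \int[lambda]_(u in `[0, 1]) h u = 1.

(** The measure has density [wrap h] cut off outside the square, and Tonelli reduces the marginals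
    to the column and row integrals. The last clause is needed to treat sets that leave the square,
    where the density statement is silent. *)
Lemma exists_wrap_permuton :
  exists mu : probability (R * R)%type R,
    [/\ is_permuton mu, has_continuous_density mu (wrap h) &
        forall A, measurable A -> mu A = mu (A `&` @unit_square R)].
Proof.
pose S := @unit_square R.
have mS : measurable S by apply: measurableX.
pose f z := (wrap h z)%:E.
have mf : measurable_fun [set: R * R] f.
  by apply/measurable_EFinP; exact: measurable_wrap.
have f_ge0 z : (0 <= f z)%E by rewrite lee_fin wrap_ge0.
have mfS : measurable_fun [set: R * R] (f \_ S).
  by apply/(measurable_restrictT _ _).1 => //; exact: measurable_funTS.
have intS (A : set (R * R)) : (\int[lambda \x lambda]_(z in A) (f \_ S) z
    = \int[lambda \x lambda]_(z in A `&` S) f z)%E.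
  by rewrite integral_mkcondr.
have row (A : set R) : measurable A -> A `<=` `[0, 1] ->
    (\int[lambda \x lambda]_(z in A `*` `[0%R, 1%R]) f z = lambda A)%E.
  move=> mA A01; rewrite integral_setX1//.
  rewrite (eq_integral (cst 1%E)) ?integral_cst ?mul1e// => x xA.
  by apply: wrap_column => //; have := A01 x; rewrite /= in_itv /=; apply; rewrite -in_setE.
have col (A : set R) : measurable A -> A `<=` `[0, 1] ->
    (\int[lambda \x lambda]_(z in `[0%R, 1%R] `*` A) f z = lambda A)%E.
  move=> mA A01; rewrite integral_setX2//.
  rewrite (eq_integral (cst 1%E)) ?integral_cst ?mul1e// => x xA.
  by apply: wrap_row => //; have := A01 x; rewrite /= in_itv /=; apply; rewrite -in_setE.
have [||mu0 muE] := exists_density_probability (nu := (lambda \x lambda)%E) mfS.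
- by move=> z; exact: erestrict_ge0.
- by rewrite intS setTI row// lebesgue_measure_itv /= lte_fin ltr01 sube0.
(* mu0 lives on the generated sigma-algebra type carrying the Lebesgue measure,
   whose measurable sets are convertible to those of R; it is repackaged. *)
pose m (A : set (R * R)%type) : \bar R := mu0 A.
have m0 : m set0 = 0%E by exact: measure0.
have m_ge0 A : (0 <= m A)%E by exact: measure_ge0.
have m_add : semi_sigma_additive m := @measure_semi_sigma_additive _ _ _ mu0.
have mT : m setT = 1%E by exact: probability_setT.
pose isM := isMeasure.Build _ _ R m m0 m_ge0 m_add.
pose M : {measure set (R * R)%type -> \bar R} := HB.pack m isM.
pose mu : probability (R * R)%type R :=
  HB.pack m isM (@Measure_isProbability.Build _ _ R M mT).
have {}muE (A : set (R * R)%type) :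
  mu A = (\int[lambda \x lambda]_(x in A) (f \_ S) x)%E by exact: muE.
exists mu; split.
- move=> A mA A01; rewrite !muE !intS !setIidl ?row ?col//.
    by move=> [x y] [/= ? ?]; split => //=; exact: A01.
  by move=> [x y] [/= ? ?]; split => //=; exact: A01.
- split.
  + by apply: continuous_subspaceT => z; exact: wrap_continuous.
  + by move=> z _; exact: wrap_ge0.
  + by move=> A mA AS; rewrite muE intS setIidl.
- by move=> A mA; rewrite !muE !intS -setIA setIid.
Qed.

End WrappedPermuton.

(** * The profile of the density *)

Section Bump.
Context (R : realType) (eps : R).
Local Notation lambda := (@lebesgue_measure R).
Hypothesis eps_gt0 : 0 < eps.

(** The function is locally constant at negative points and differentiable at positive ones; at 0
    the two one-sided limits are compared. *)
Lemma continuous_max0_powR : continuous (fun u : R => Num.max 0 u `^ eps).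
Proof.
move=> u; have [u0|u0|->] := ltgtP u 0.
- apply: (@near_cst_continuous _ _ 0).
  near=> v; rewrite max_l ?powR0 ?gt_eqF//.
  by near: v; exact: lt_le_nbhsl.
- have : {for u, continuous (fun v : R => v `^ eps)}.
    apply: differentiable_continuous; apply/derivable1_diffP.
    by apply: derivable_powR; rewrite in_itv /= u0.
  move=> cu; rewrite /continuous_at max_r ?ltW//.
  apply: cvg_trans cu; apply: near_eq_cvg.
  by near=> v; rewrite max_r//; apply: ltW; near: v; exact: lt_nbhsr.
- apply/left_right_continuousP; rewrite /= maxxx powR0 ?gt_eqF//; split.
  + apply: cvg_near_cst; near=> v; rewrite max_l ?powR0 ?gt_eqF//.
  + apply: cvg_trans (powR_cvg0 eps_gt0); apply: near_eq_cvg.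
    by near=> v; rewrite max_r.
Unshelve. all: by end_near. Qed.

(** A tent over [0, 1/2] raised to the power [eps], not yet normalised. It decays like the power
    [eps] of the distance at 1/2, which sets the masses of the triangles, and vanishes at 0, so that
    its extension by zero is continuous. *)
Definition bump (t : R) : R := Num.max 0 (Num.min t (2^-1 - t)) `^ eps.

Lemma continuous_bump : continuous bump.
Proof.
move=> t; apply: (@continuous_comp _ _ _ (fun t : R => Num.min t (2^-1 - t))
  (fun u => Num.max 0 u `^ eps)); last exact: continuous_max0_powR.
apply: continuous_min; first exact: cvg_id.
by apply: cvgB; [exact: cvg_cst|exact: cvg_id].
Qed.

Lemma bump_ge0 (t : R) : 0 <= bump t.
Proof. exact: powR_ge0. Qed.

Lemma bump_left (t : R) : t <= 0 -> bump t = 0.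
Proof.
by move=> t0; rewrite /bump max_l ?powR0 ?gt_eqF// ge_min t0.
Qed.

Lemma bump_right (t : R) : 2^-1 <= t -> bump t = 0.
Proof.
by move=> t0; rewrite /bump max_l ?powR0 ?gt_eqF// ge_min subr_le0 t0 orbT.
Qed.

Lemma powR_le_bump (s t : R) : 0 <= s -> s <= t -> s <= 2^-1 - t ->
  s `^ eps <= bump t.
Proof.
move=> s0 st st'; rewrite /bump; apply: ge0_ler_powR; rewrite ?nnegrE ?le_max ?lexx//.
  exact: ltW.
by rewrite le_min st st' orbT.
Qed.

Lemma integral_bump_gt0 : 0 < \int[lambda]_(u in `[0, 1]) bump u.
Proof.
have intb (a b : R) : lambda.-integrable `[a, b] (EFin \o bump).
  apply: continuous_compact_integrable; first exact: segment_compact.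
  by apply: continuous_subspaceT; exact: continuous_bump.
(* On [1/8, 3/8] the tent is at least 1/8. *)
apply: (@lt_le_trans _ _ (\int[lambda]_(u in `[8^-1, 3 / 8]) 8^-1 `^ eps)).
  rewrite Rintegral_cst//= lebesgue_measure_itv /= lte_fin ifT; last lra.
  by rewrite mulr_gt0 ?powR_gt0//=; lra.
apply: (@le_trans _ _ (\int[lambda]_(u in `[8^-1, 3 / 8]) bump u)).
  apply: le_Rintegral => //.
    apply: continuous_compact_integrable; first exact: segment_compact.
    by apply: continuous_subspaceT => ?; exact: cvg_cst.
  by move=> u; rewrite /= in_itv /= => /andP[u1 u2]; apply: powR_le_bump; lra.
rewrite fine_le ?integrable_fin_num//.
apply: ge0_subset_integral => //.
- apply/measurable_EFinP; apply: measurable_funTS.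
  exact: continuous_measurable_fun continuous_bump.
- by move=> u _; rewrite lee_fin bump_ge0.
- by apply: subset_itv; rewrite bnd_simp; lra.
Qed.

End Bump.

Lemma measurable_above_line (R : realType) (a : R) :
  measurable [set z : R * R | z.1 + a < z.2].
Proof.
have m1 : measurable_fun [set: R * R] (fun z : R * R => z.1 + a).
  by apply: measurable_funD; [exact: measurable_fst|exact: measurable_cst].
have := measurable_fun_ltr m1 measurable_snd measurableT.
by move=> /(_ [set true] I); rewrite setTI.
Qed.

Lemma density_rectangle_ge (R : realType) (mu : probability (R * R)%type R)
    (rho : R * R -> R) (A B : set R) (r : R) :
    has_continuous_density mu rho -> measurable_fun [set: R * R] rho ->
    measurable A -> measurable B -> A `*` B `<=` @unit_square R -> 0 <= r ->
    (forall z, (A `*` B) z -> r <= rho z) ->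
  (r%:E * (lebesgue_measure A * lebesgue_measure B) <= mu (A `*` B))%E.
Proof.
move=> [_ rho_ge0 muE] mrho mA mB ABS r0 r_rho.
have mAB : measurable (A `*` B) by exact: measurableX.
rewrite muE// -product_measure1E// -integral_cst//.
apply: ge0_le_integral => //=.
by apply/measurable_EFinP; exact: measurable_funTS.
Qed.

(* The density vanishes above the line y = x + 1/2 and is of order s ^ eps at
   depth s below it. The rectangle is contained in the triangle cut off the
   support by the quadrant to the upper left of (x + w, x + 1/2), at depths
   between w / 3 and w. *)
Lemma exists_permuton_with_boundary (R : realType) (eps : R) : 0 < eps ->
  exists (mu : probability (R * R)%type R) (rho : R * R -> R) (kappa : R),
    [/\ is_permuton mu, has_continuous_density mu rho,
        forall y : R, 2^-1 <= y <= 1 -> rho (0, y) = 0,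
        mu [set z | z.1 + 2^-1 < z.2] = 0%E &
        0 < kappa /\ forall x w : R, 0 <= x -> 0 < w -> w <= 4^-1 -> x + w <= 2^-1 ->
          ((kappa * w `^ (2 + eps))%:E <=
           mu ([set` `[(x + 2 / 3 * w)%R, (x + w)%R[] `*`
               [set` `[(x + 2^-1)%R, (x + 2^-1 + w / 3)%R]]))%E].
Proof.
move=> eps0; set C := \int[@lebesgue_measure R]_(u in `[0, 1]) bump eps u.
have C0 : 0 < C by exact: integral_bump_gt0.
pose h t := C^-1 * bump eps t.
have h_cont : continuous h.
  by move=> t; apply: cvgM; [exact: cvg_cst|exact: continuous_bump].
have h_ge0 (t : R) : 0 <= h t.
  by rewrite mulr_ge0 ?bump_ge0// invr_ge0 ltW.
have h_left (t : R) : t <= 0 -> h t = 0 by move=> ?; rewrite /h bump_left ?mulr0.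
have h_half (t : R) : 2^-1 <= t -> h t = 0 by move=> ?; rewrite /h bump_right ?mulr0.
have h_right (t : R) : 1 <= t -> h t = 0 by move=> ?; rewrite h_half//; lra.
have h_int1 : \int[@lebesgue_measure R]_(u in `[0, 1]) h u = 1.
  rewrite RintegralZl//= ?mulVf ?gt_eqF//.
  apply: continuous_compact_integrable; first exact: segment_compact.
  by apply: continuous_subspaceT; exact: continuous_bump.
have [mu [mu_perm mu_dens mu_square]] :=
  exists_wrap_permuton h_cont h_ge0 h_left h_right h_int1.
exists mu, (wrap h), (C^-1 * (3^-1 `^ eps / 9)); split=> //.
- move=> y /andP[y2 _]; rewrite /wrap /= subr0 !h_half ?addr0//; lra.
- have mN := @measurable_above_line R 2^-1.
  rewrite mu_square//; case: mu_dens => _ _ -> //; last first.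
    by apply: measurableI => //; exact: measurableX.
  apply: integral0_eq => z [/= zN _]; congr EFin.
  by rewrite /wrap !h_half ?addr0//; lra.
split; first by rewrite !mulr_gt0 ?invr_gt0 ?powR_gt0.
move=> x w x0 w0 w4 xw.
set A := [set` _]; set B := [set` _].
have := @density_rectangle_ge R mu (wrap h) A B (C^-1 * (w / 3) `^ eps) mu_dens.
have -> : lebesgue_measure A = (w / 3)%:E.
  rewrite lebesgue_measure_itv /= lte_fin ifT; last lra.
  by congr EFin; lra.
have -> : lebesgue_measure B = (w / 3)%:E.
  rewrite lebesgue_measure_itv /= lte_fin ifT; last lra.
  by congr EFin; lra.
move=> H; apply: le_trans (H _ _ _ _ _ _) => //.
- rewrite -!EFinM lee_fin powRD; last by apply/implyP => _; rewrite gt_eqF.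
  rewrite powRM ?invr_ge0//; last exact: ltW.
  rewrite powR_mulrn; last exact: ltW.
  have e (c a b : R) : c * (a / 9) * (w ^+ 2 * b) = c * (b * a) * (w / 3 * (w / 3)).
    by field.
  by rewrite e.
- exact: measurable_wrap.
- exact: measurable_itv.
- exact: measurable_itv.
- rewrite /A /B => -[u v] [/= + +]; rewrite !in_itv /= => /andP[u1 u2] /andP[v1 v2].
  by split; rewrite /= in_itv /=; apply/andP; split; lra.
- by rewrite mulr_ge0 ?powR_ge0// invr_ge0 ltW.
- rewrite /A /B => -[u v] [/= + +]; rewrite !in_itv /= => /andP[u1 u2] /andP[v1 v2].
  (* Only the summand at v - u is kept. On the cell, 1/2 - (v - u) is at least w/3, and v - u
     exceeds 1/2 - w, which is at least 1/4 and hence at least w/3. *)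
  rewrite /wrap /= -[leLHS]addr0 lerD//.
  rewrite ler_pM2l ?invr_gt0// powR_le_bump//; lra.
Qed.

(** * Occupation of cells by independent points *)

Section IidPoints.
Context (R : realType) (d d' : measure_display).
Context (T : measurableType d) (T' : measurableType d').
Context (P : probability T R) (mu : probability T' R).
Context (n : nat) (X : 'I_n -> {RV P >-> T'}).
Hypothesis X_iid : iid X mu.

Lemma measurable_all_points (A : set T') :
  measurable A -> measurable [set w | forall i, A (X i w)].
Proof.
move=> mA; rewrite [X in measurable X](_ : _ = \bigcap_(i in setT) (X i @^-1` A)).
  apply: fin_bigcap_measurable => [|i _]; first exact: finite_finset.
  by rewrite -[X in measurable X]setTI; apply: measurable_funPT.
by apply/seteqP; split => [w wA i _|w wA i]; exact: wA.
Qed.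

Lemma iid_all_points (A : set T') : measurable A ->
  P [set w | forall i, A (X i w)] = (fine (mu A) ^+ n)%:E.
Proof.
move=> mA; case: X_iid => indep dist.
rewrite (_ : [set w | _] = \bigcap_i (X i @^-1` A)); last first.
  by apply/seteqP; split => [w wA i _|w wA i]; exact: wA.
rewrite indep// (eq_bigr (fun=> (fine (mu A))%:E)) => [|i _].
  by rewrite prodEFin prodr_const card_ord.
rewrite fineK ?fin_num_measure//; exact: dist.
Qed.

(** The probability is the n-th power of 1 - mu(A), and 1 - mu(A) <= 1 - p <= exp (- p). *)
Lemma iid_miss_le (A : set T') (p : R) : measurable A -> (p%:E <= mu A)%E ->
  (P [set w | forall i, ~ A (X i w)] <= (expR (- (n%:R * p)))%:E)%E.
Proof.
move=> mA pA; rewrite (iid_all_points (measurableC mA)) lee_fin.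
rewrite -mulrN expRM_natl lerXn2r ?nnegrE ?expR_ge0 ?fine_ge0//.
apply: le_trans (expR_ge1Dx _).
rewrite -lee_fin fineK ?fin_num_measure//; last exact: measurableC.
by rewrite probability_setC// EFinD EFinN leeB.
Qed.

(** Outside [V], either some point falls into the null set [N] or one of the [m] cells is missed by
    all points; a union bound over the cells concludes. *)
Lemma iid_occupied_ge (N : set T') (B : nat -> set T') (m : nat) (p : R)
    (V : set T) :
    measurable N -> mu N = 0%E -> measurable V ->
    (forall j, measurable (B j)) -> (forall j, (j < m)%N -> (p%:E <= mu (B j))%E) ->
    (forall w, (forall i, ~ N (X i w)) ->
       (forall j, (j < m)%N -> exists i, B j (X i w)) -> V w) ->
  ((1 - m%:R * expR (- (n%:R * p)))%:E <= P V)%E.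
Proof.
move=> mN N0 mV mB pB sub.
pose miss j := [set w | forall i, ~ B j (X i w)].
pose avoid := [set w | forall i, ~ N (X i w)].
have m_miss j : measurable (miss j) by exact: measurable_all_points (measurableC _).
have m_avoid : measurable avoid by exact: measurable_all_points (measurableC _).
have avoid1 : P (~` avoid) = 0%E.
  rewrite probability_setC// (iid_all_points (measurableC mN)).
  by rewrite probability_setC// N0 sube0 /= expr1n subee.
have VC : ~` V `<=` ~` avoid `|` \big[setU/set0]_(j < m) miss j.
  move=> w nVw; apply: contrapT; rewrite not_orP notK => -[wN].
  rewrite -bigcup_mkord => wB; apply: nVw; apply: sub => // j jm.
  by apply: contrapT => /forallNP wj; apply: wB; exists j.
have : (P (~` V) <= (m%:R * expR (- (n%:R * p)))%:E)%E.
  have mU : measurable (\big[setU/set0]_(j < m) miss j) by exact: bigsetU_measurable.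
  apply: (@le_trans _ _ (P (~` avoid `|` \big[setU/set0]_(j < m) miss j))).
    by apply: le_measure => //; rewrite inE; [exact: measurableC|apply: measurableU => //; exact: measurableC].
  have PU : (P (~` avoid `|` \big[setU/set0]_(j < m) miss j) <=
      P (~` avoid) + P (\big[setU/set0]_(j < m) miss j))%E.
    exact: measureU2 (measurableC m_avoid) mU.
  apply: (le_trans PU); rewrite avoid1 add0e; apply: (le_trans (Boole_inequality _ _)) => //.
  apply: (@le_trans _ _ (\sum_(j < m) (expR (- (n%:R * p)))%:E)%E).
    by apply: lee_sum => j _; apply: iid_miss_le => //; exact: pB.
  by rewrite sumEFin sumr_const card_ord -[expR _ *+ m]mulr_natl.
rewrite probability_setC// EFinB => PV.
by rewrite leeBlDr// addeC -leeBlDr ?fin_num_measure.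
Qed.

End IidPoints.

(** * Asymptotics of the union bound *)

Section Asymptotics.
Context (R : realType).

(** Raise exp (x / k) >= 1 + x / k >= x / k to the power [k] and invert. *)
Lemma expRN_le_powers (k : nat) (x : R) : (0 < k)%N -> 0 < x ->
  expR (- x) <= (k%:R / x) ^+ k.
Proof.
move=> k0 x0; have k0' : 0 < k%:R :> R by rewrite ltr0n.
rewrite expRN -[k%:R / x]invf_div exprVn lef_pV2 ?posrE ?expR_gt0 ?exprn_gt0 ?divr_gt0//.
have -> : expR x = expR (x / k%:R) ^+ k.
  by rewrite -expRM_natl mulrC divfK ?gt_eqF.
rewrite lerXn2r ?nnegrE ?expR_ge0 ?divr_ge0 ?(ltW x0) ?(ltW k0')//.
by apply: le_trans _ (expR_ge1Dx _); rewrite lerDr.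
Qed.

(* n ^ b cells, each of them missed by n points with probability at most
   exp (- kappa (n ^ -b) ^ (2 + eps) n) *)
Lemma union_bound_le (b eps kappa : R) : 0 < b -> b * (2 + eps) < 1 ->
    0 < eps -> 0 < kappa ->
  exists K gamma : R, 0 < gamma /\ forall (n : nat) (m : R),
    (0 < n)%N -> 0 < m -> m <= 3 * n%:R `^ b ->
    m * expR (- (n%:R * (kappa * (2 * m)^-1 `^ (2 + eps)))) <=
    K * n%:R^-1 `^ gamma.
Proof.
move=> b0 b1 eps0 kappa0.
set gamma := 1 - b * (2 + eps).
have gamma0 : 0 < gamma by rewrite subr_gt0.
(* The exponent [k] is so large that [n ^ b] is at most the k-th power of [u = n ^ gamma]. Bounding
   the exponential by the power [k.+1] of a multiple of 1/u then leaves a factor 1/u. *)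
pose k := (Num.truncn gamma^-1).+1.
have gk : 1 <= gamma * k%:R.
  by rewrite -ler_pdivrMl// mulr1 ltW// truncnS_gt.
pose kappa1 := kappa * 6^-1 `^ (2 + eps).
have kappa1_gt0 : 0 < kappa1 by rewrite mulr_gt0 ?powR_gt0.
exists (3 * (k.+1%:R / kappa1) ^+ k.+1), gamma; split=> // n m n0 m0 mn.
have n1 : 1 <= n%:R :> R by rewrite ler1n.
have nR0 : 0 < n%:R :> R by rewrite ltr0n.
set u := n%:R `^ gamma; have u0 : 0 < u by rewrite powR_gt0.
have m_le : m <= 3 * u ^+ k.
  apply: (le_trans mn); rewrite ler_pM2l//.
  rewrite -powR_mulrn ?powR_ge0// -powRrM ler_powR//.
  (* Here b <= b (2 + eps) < 1 <= gamma k. *)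
  apply: (le_trans _ gk); apply: ltW; apply: le_lt_trans b1.
  by rewrite ler_peMr ?ltW//; lra.
have np_ge : kappa1 * u <= n%:R * (kappa * (2 * m)^-1 `^ (2 + eps)).
  have w_ge : 6^-1 * n%:R `^ (- b) <= (2 * m)^-1.
    rewrite powRN -invfM lef_pV2 ?posrE ?mulr_gt0 ?powR_gt0//; lra.
  have : (6^-1 * n%:R `^ (- b)) `^ (2 + eps) <= (2 * m)^-1 `^ (2 + eps).
    apply: ge0_ler_powR => //; rewrite ?nnegrE; first by lra.
      by rewrite mulr_ge0 ?powR_ge0.
    by rewrite invr_ge0 mulr_ge0// ltW.
  rewrite powRM ?powR_ge0// -powRrM mulNr => w_ge'.
  have -> : kappa1 * u = n%:R * (kappa * (6^-1 `^ (2 + eps) * n%:R `^ (- (b * (2 + eps))))).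
    rewrite /u /gamma powRD; last by apply/implyP => _; rewrite gt_eqF.
    by rewrite powRr1 ?ltW// /kappa1; ring.
  by rewrite !ler_pM2l.
apply: (@le_trans _ _ (3 * u ^+ k * (k.+1%:R / (kappa1 * u)) ^+ k.+1)).
  apply: ler_pM => //; first exact: ltW.
  apply: (@le_trans _ _ (expR (- (kappa1 * u)))); first by rewrite ler_expR lerN2.
  by apply: expRN_le_powers => //; rewrite mulr_gt0.
have -> : n%:R^-1 `^ gamma = u^-1.
  by rewrite -[n%:R^-1]powR_inv1 ?ler0n// -powRrM mulN1r powRN.
have u_neq0 := lt0r_neq0 u0; have k1_neq0 := lt0r_neq0 kappa1_gt0.
rewrite (_ : k.+1%:R / (kappa1 * u) = (k.+1%:R / kappa1) * u^-1); last first.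
  by rewrite invfM mulrA.
rewrite exprMn [in X in _ * (_ * X) <= _]exprS exprVn.
have e (A : R) : 3 * u ^+ k * (A * (u^-1 / u ^+ k)) = 3 * A / u * (u ^+ k / u ^+ k).
  by ring.
by rewrite e (divff (expf_neq0 _ u_neq0)) mulr1.
Qed.

Lemma cvg_powR_invn (gamma : R) : 0 < gamma ->
  n%:R^-1 `^ gamma @[n --> \oo] --> (0 : R).
Proof.
move=> gamma0.
have := @continuous_max0_powR _ _ gamma0 0; rewrite /continuous_at maxxx powR0 ?gt_eqF//.
(* The shift by one matches the harmonic sequence 1 / (n + 1), along which continuity at 0 is
   applied. *)
move=> c0; rewrite -(cvg_shiftS (fun n : nat => n%:R^-1 `^ gamma)).
have := cvg_comp (fun n : nat => harmonic n) _ (@cvg_harmonic R) c0.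
apply: cvg_trans; apply: near_eq_cvg; apply: nearW => n /=.
by rewrite /harmonic max_r ?invr_ge0.
Qed.

End Asymptotics.

(** * The height of the tree of random points *)

Lemma probability_height_ge (R : realType) (mu : probability (R * R)%type R)
    (eps kappa : R) (d : measure_display) (T : measurableType d)
    (P : probability T R) (n : nat) (X : 'I_n -> {RV P >-> (R * R)%type})
    (m : nat) (r : R) :
    mu [set z | z.1 + 2^-1 < z.2] = 0%E ->
    (forall x w : R, 0 <= x -> 0 < w -> w <= 4^-1 -> x + w <= 2^-1 ->
      ((kappa * w `^ (2 + eps))%:E <=
       mu ([set` `[(x + 2 / 3 * w)%R, (x + w)%R[] `*`
           [set` `[(x + 2^-1)%R, (x + 2^-1 + w / 3)%R]]))%E) ->
    iid X mu -> (1 < m)%N -> r <= m.-1%:R ->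
  ((1 - m%:R * expR (- (n%:R * (kappa * (2 * m%:R)^-1 `^ (2 + eps)))))%:E <=
   P [set w | (r <= (height (bst_of_points (random_points X w)))%:R)%R])%E.
Proof.
move=> N0 mu_box X_iid m1 rm.
have m0 : 0 < m%:R :> R by rewrite ltr0n ltnW.
set w : R := (2 * m%:R)^-1.
have w0 : 0 < w by rewrite invr_gt0 mulr_gt0.
have mw : m%:R * w = 2^-1 by rewrite /w invfM mulrCA divff ?mulr1 ?gt_eqF.
(* This bound, required by the mass estimate of the cells, is where at least two cells are
   needed. *)
have w4 : w <= 4^-1.
  have : 2 * w <= m%:R * w by rewrite ler_pM2r// ler_nat.
  by rewrite mw; lra.
pose x (j : nat) := j%:R * w.
apply: (@iid_occupied_ge _ _ _ _ _ _ _ _ _ X_iid [set z | z.1 + 2^-1 < z.2]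
  (fun j => [set` `[x j + 2 / 3 * w, x j + w[] `*`
            [set` `[x j + 2^-1, x j + 2^-1 + w / 3]])) => //.
- exact: measurable_above_line.
- exact: measurable_height_ge.
- by move=> j; apply: measurableX; exact: measurable_itv.
- move=> j jm; apply: mu_box => //; first by rewrite mulr_ge0// ltW.
  rewrite -mw /x -[X in _ + X]mul1r -mulrDl ler_pM2r//.
  by rewrite natr1 ler_nat.
move=> t tN tB; apply: (le_trans rm); rewrite ler_nat.
apply: (@height_bst_of_points_ge _ _ 2^-1 x) => [j k jk|p|j jm].
- by rewrite ler_pM2r// ler_nat.
- by move=> /imfsetP[i _ ->]; rewrite leNgt; apply/negP; exact: tN.
- have [i [/=]] := tB _ jm; rewrite !in_itv /= => /andP[_ xi] /andP[yi _].
  exists (X i t); first by apply/imfsetP; exists i.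
  by split=> //; rewrite /x -natr1 mulrDl mul1r.
Qed.

Theorem mainTheorem3 (R : realType) (delta : R) (delta_gt0 : 0 < delta) :
  exists (mu : probability (R * R)%type R) (rho : R * R -> R) (c : R),
    [/\ is_permuton mu,
        has_continuous_density mu rho,
        forall y : R, 2^-1 <= y <= 1 -> rho (0, y) = 0,
        0 < c &
        forall (d : nat -> measure_display)
               (T : forall n, measurableType (d n))
               (P : forall n, probability (T n) R)
               (X : forall n, 'I_n -> {RV (P n) >-> (R * R)%type}),
          (forall n, iid (X n) mu) ->
          P n [set w | c * n%:R `^ ((1 - delta) / 2)
                       <= (height (bst_of_points (random_points (X n) w)))%:R]
            @[n --> \oo] --> 1%E].
Proof.
(* The maximum with 1/4 keeps [b] positive even if [delta] is at least 1, while [b] stays below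
   1/2. *)
pose b := Num.max ((1 - delta) / 2) 4^-1.
have b_ge : (1 - delta) / 2 <= b by rewrite le_max lexx.
have b0 : 0 < b by rewrite lt_max invr_gt0 ltr0n orbT.
have b2 : b < 2^-1 by rewrite gt_max; apply/andP; split; lra.
(* Half of the critical value 1/b - 2, for which b (2 + eps) would equal 1; with this choice it
   equals b + 1/2. *)
pose eps := (b^-1 - 2) / 2.
have eps0 : 0 < eps.
  have : 2 < b^-1 by rewrite -[2]invrK ltf_pV2 ?posrE ?invr_gt0.
  by rewrite /eps; lra.
have beps : b * (2 + eps) < 1.
  have -> : b * (2 + eps) = b + 2^-1 by rewrite /eps; field; rewrite gt_eqF.
  by lra.
have [mu [rho [kappa [perm dens rho0 N0 [kappa0 mu_box]]]]] :=
  exists_permuton_with_boundary eps0.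
exists mu, rho, 1; split=> // d T P X X_iid.
have [K [gamma [gamma0 bound]]] := union_bound_le b0 beps eps0 kappa0.
pose lower (n : nat) : R := 1 - K * n%:R^-1 `^ gamma.
apply: (@squeeze_cvge _ _ _ _ (EFin \o lower) _ (cst 1%E)).
- near=> n.
  have n0 : (0 < n)%N by near: n; exists 1%N.
  have n1 : 1 <= n%:R :> R by rewrite ler1n.
  rewrite probability_le1 ?andbT; last exact: measurable_height_ge.
  set y := n%:R `^ b.
  have y1 : 1 <= y by rewrite -(powRr0 n%:R) ler_powR // ltW.
  (* The chain yields height at least [m.-1], which exceeds [y = n ^ b], so that [c = 1] suffices.
     Moreover [m >= 2], and [m <= y + 2 <= 3 y] because [y >= 1]. *)
  pose m := (Num.truncn y).+2.
  apply: le_trans (probability_height_ge N0 mu_box (X_iid n) (m := m) _ _) => //.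
    rewrite lee_fin lerD2l lerN2; apply: bound => //.
    rewrite -/y /m -[_.+2]addn2 natrD.
    have : (Num.truncn y)%:R <= y by rewrite truncn_le (le_trans ler01).
    by lra.
  rewrite mul1r; apply: (@le_trans _ _ y); first exact: ler_powR.
  by apply: ltW; exact: truncnS_gt.
- apply: cvg_EFin; first exact: nearW.
  rewrite -[X in _ --> X]subr0; apply: cvgB; first exact: cvg_cst.
  by rewrite -[X in _ --> X](mulr0 K); apply: cvgM; [exact: cvg_cst|exact: cvg_powR_invn].
- exact: cvg_cst.
Unshelve. all: by end_near. Qed.
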